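(* Let $X$ be a non-empty finite set, $V^1,\dots,V^n:\Delta(X)\to\mathbb{R}$ continuous functions, $f:\mathbb{R}^n\to\mathbb{R}$ a continuous function, and $D:\Delta(X)\rightrightarrows\mathbb{R}^n$ a closed-valued correspondence. Let $\mu\in\Delta(X)$ and suppose $\mathcal{V}(\mu)\cap D(\mu)\neq\emptyset$, where $$\mathcal{V}(\mu)=\left\{\left(E_P[V^1],\dots,E_P[V^n]\right)\ :\ P\in\Delta^2(X),\ E_P[\nu]=\mu\right\}.$$ Then there exists $P^*\in\Delta^2(X)$ with $|\mathrm{supp}(P^* )|\le (n+1)\cdot|X|$ that solves the problem $$\sup_{P\in\Delta^2(X)} f\left(E_P[V^1],\dots,E_P[V^n]\right)\quad\text{s.t.}\quad \left(E_P[V^1],\dots,E_P[V^n]\right)\in D(\mu),\ \ E_P[\nu]=\mu,$$ i.e. $P^*$ is feasible and attains the supremum.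
   Context: $\Delta(X)\subset\mathbb{R}^{|X|}$ is the simplex of probability measures on the finite set $X$, and $\Delta^2(X)$ is the set of all Borel probability measures on $\Delta(X)$. For $P\in\Delta^2(X)$, $E_P[\nu]=\int_{\Delta(X)}\nu\,dP(\nu)$ is the barycenter and $E_P[V]=\int_{\Delta(X)}V(\nu)\,dP(\nu)$; $\mathrm{supp}(P)$ is the support of $P$. *)

(* Defs.v *)
From HB Require Import structures.
From mathcomp Require Import all_boot all_order all_algebra.
From mathcomp Require Import all_classical all_reals all_analysis.
Import Order.TTheory GRing.Theory Num.Theory numFieldNormedType.Exports.

Set Implicit Arguments.
Unset Strict Implicit.
Unset Printing Implicit Defensive.

Local Open Scope classical_set_scope.
Local Open Scope ring_scope.

(* R^X is represented by row vectors, the coordinate of [x] being [enum_rank x]. *)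
Definition simplex (R : realType) (X : finType) : set 'rV[R]_#|X| :=
  [set v | (forall x : X, 0 <= v 0 (enum_rank x)) /\
           \sum_(x : X) v 0 (enum_rank x) = 1].

(* The simplex as a type of its own, with the subspace topology.  The proof [X0]
   of non-emptiness is a parameter because measurable types must be pointed. *)
Definition Delta (R : realType) (X : finType) (X0 : (0 < #|X|)%N) : Type :=
  set_type (@simplex R X).

Lemma uniform_simplex (R : realType) (X : finType) (X0 : (0 < #|X|)%N) :
  (const_mx (#|X|%:R^-1) : 'rV[R]_#|X|) \in @simplex R X.
Proof.
apply/mem_set; split=> [x|]; first by rewrite mxE invr_ge0 ler0n.
under eq_bigr do rewrite mxE.
by rewrite sumr_const -[LHS]mulr_natr mulVf// pnatr_eq0 -lt0n.
Qed.

HB.instance Definition _ (R : realType) (X : finType) (X0 : (0 < #|X|)%N) :=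
  PseudoMetric.copy (Delta R X0) (set_type (@simplex R X)).
HB.instance Definition _ (R : realType) (X : finType) (X0 : (0 < #|X|)%N) :=
  isPointed.Build (Delta R X0)
    (exist (fun v => v \in @simplex R X) _ (uniform_simplex R X0)).

Definition Delta2 (R : realType) (X : finType) (X0 : (0 < #|X|)%N) : Type :=
  probability (g_sigma_algebraType (@open (Delta R X0))) R.

Section persuasion.
Context (R : realType) (X : finType) (X0 : (0 < #|X|)%N).
Implicit Types (P : Delta2 R X0) (mu : Delta R X0).

(* [\int] is the real-valued Lebesgue integral, junk outside integrable
   functions; every integrand below is continuous on a compact space. *)
Definition barycenter P : 'rV[R]_#|X| :=
  \row_i (\int[P]_(nu in setT) (val (nu : Delta R X0)) 0 i)%R.

Definition expectations (n : nat) (V : 'I_n -> Delta R X0 -> R) P : 'rV[R]_n :=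
  \row_i (\int[P]_(nu in setT) V i nu)%R.

Definition supp P : set (Delta R X0) :=
  \bigcap_(C in [set C : set (Delta R X0) | closed C /\ P C = 1%E]) C.

Definition attainable (n : nat) (V : 'I_n -> Delta R X0 -> R) mu :
    set 'rV[R]_n :=
  [set expectations V P | P in [set P | barycenter P = val mu]].

Definition feasible (n : nat) (V : 'I_n -> Delta R X0 -> R)
    (D : Delta R X0 -> set 'rV[R]_n) mu : set (Delta2 R X0) :=
  [set P | D mu (expectations V P) /\ barycenter P = val mu].

Definition solves (n : nat) (V : 'I_n -> Delta R X0 -> R) (f : 'rV[R]_n -> R)
    (D : Delta R X0 -> set 'rV[R]_n) mu P : Prop :=
  feasible V D mu P /\
  (f (expectations V P))%:E =
    ereal_sup [set (f (expectations V Q))%:E | Q in feasible V D mu].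

End persuasion.

(* Main.v *)
From HB Require Import structures.
Require Import Defs.
From mathcomp Require Import all_boot all_order all_algebra.
From mathcomp Require Import all_classical all_reals all_analysis.
From mathcomp Require Import measurable_realfun ring lra.
Import Order.TTheory GRing.Theory Num.Theory numFieldNormedType.Exports.

Set Implicit Arguments.
Unset Strict Implicit.
Unset Printing Implicit Defensive.

Local Open Scope classical_set_scope.
Local Open Scope ring_scope.

(** The problem depends on a law [P] only through finitely many moments: the
    [#|X|] coordinates of its barycenter and the [n] expectations of the [V i].
    Together these are the integrals of [d = #|X| + n] continuous functions on
    the compact space [Delta].

    The key fact, a form of the Richter-Tchakaloff theorem, is
    [moments_finite_law]: on a compact space, the moments of a Borel probability
    with respect to [d] continuous functions, one linear combination of which is
    constantly 1, are also the moments of a probability with at most [d] atoms.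
    On [Delta] the combination is the sum of the coordinates.  To prove it, let
    [c] be a moment vector of a [d]-atom law at least distance from the target
    [y]; it exists because [d]-atom laws are parametrised by a compact set.
    Moving a little mass to any point [x] keeps at most [d] atoms, after a
    Caratheodory reduction ([moment_segment]), so minimality gives
    [(y - c) . (g x - c) <= 0].  Integrating over [x] yields
    [|y - c| ^ 2 <= 0].

    Hence maximising over all feasible laws amounts to maximising over the
    feasible [d]-atom laws.  These form a non-empty compact set, on which the
    objective is continuous, so the maximum is attained.  The optimal law has at
    most [#|X| + n] atoms, and [#|X| + n <= (n + 1) * #|X|] as [X] is
    non-empty. *)

(** * Caratheodory reduction *)

Section caratheodory.
Context (F : realFieldType) (d : nat).

(** There are more rows than columns, so the rows are linearly dependent.  The
    hypothesis puts them on an affine hyperplane missing the origin; the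
    coefficients of the relation then sum to 0, so one of them is positive. *)
Lemma affine_dependence (G : 'M[F]_(d.+1, d)) (b : 'cV[F]_d) :
  G *m b = const_mx 1 ->
  exists a : 'rV[F]_d.+1, a *m G = 0 /\ exists i, 0 < a 0 i.
Proof.
move=> Gb.
have kG0 : kermx G != 0.
  by rewrite -mxrank_eq0 mxrank_ker subn_eq0 -ltnNge ltnS rank_leq_col.
have [k ak0] : exists k, row k (kermx G) != 0.
  apply/existsP; apply: contra_neqT kG0 => /existsPn ak0.
  apply/row_matrixP => k; rewrite row0; apply/eqP.
  by move: (ak0 k); rewrite negbK.
set a := row k _ in ak0.
have aG : a *m G = 0 by rewrite /a -row_mul mulmx_ker row0.
exists a; split=> //; apply: contrapT => /forallNP a_le0.
have sum_a : \sum_i a 0 i = 0.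
  transitivity ((a *m G *m b) 0 0); last by rewrite aG mul0mx mxE.
  rewrite -mulmxA Gb mxE; apply: eq_bigr => i _.
  by rewrite [const_mx _ _ _]mxE mulr1.
have Na_ge0 i : 0 <= - a 0 i by rewrite oppr_ge0 leNgt; apply/negP.
case/negP: ak0; apply/eqP/rowP => i; rewrite [RHS]mxE; apply/eqP.
rewrite -oppr_eq0; have /eqP := sum_a.
rewrite -oppr_eq0 -sumrN psumr_eq0; last by move=> j _; exact: Na_ge0.
by move/allP/(_ i (mem_index_enum i)).
Qed.

(** Subtract from the weights the largest multiple of a linear relation between
    the rows that keeps them non-negative: the first weight to vanish is freed. *)
Lemma caratheodory_step (G : 'M[F]_(d.+1, d)) (b : 'cV[F]_d)
    (w : 'rV[F]_d.+1) :
  G *m b = const_mx 1 -> (forall i, 0 <= w 0 i) ->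
  exists2 w' : 'rV[F]_d.+1, w' *m G = w *m G &
    (forall i, 0 <= w' 0 i) /\ exists i, w' 0 i = 0.
Proof.
move=> Gb w_ge0; have [a [aG [i0 ai0]]] := affine_dependence Gb.
case: (@arg_minP _ _ _ i0 (fun i => 0 < a 0 i) (fun i => w 0 i / a 0 i) ai0).
move=> i1 ai1 minw; pose s := w 0 i1 / a 0 i1.
exists (w - s *: a); first by rewrite mulmxBl -scalemxAl aG scaler0 subr0.
split=> [i|]; last by exists i1; rewrite !mxE divfK ?subrr// gt_eqF.
rewrite !mxE subr_ge0; have [ai|ai] := ltP 0 (a 0 i).
  by rewrite -ler_pdivlMr//; exact: minw.
apply: le_trans (w_ge0 i); by rewrite mulr_ge0_le0// divr_ge0// ltW.
Qed.

End caratheodory.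

(** * Continuity and compactness *)

Lemma mx_coord_continuous (T : topologicalType) m n i j :
  continuous (fun M : 'M[T]_(m, n) => M i j).
Proof.
move=> M A MA; exists (fun k l => if (k == i) && (l == j) then A else setT).
  by move=> k l; case: ifPn => [/andP[/eqP-> /eqP->]//|_]; exact: filterT.
by move=> N /(_ i j); rewrite !eqxx.
Qed.

Lemma continuous_mx (S T : topologicalType) m n (f : S -> 'M[T]_(m, n)) :
  (forall i j, continuous (fun s => f s i j)) -> continuous f.
Proof.
move=> cf s A [P sP PA].
have : \forall u \near s, forall i j, P i j (f u i j).
  apply: filter_forall => i; apply: filter_forall => j; exact: cf.
by apply: filterS => u Pu; exact: PA.
Qed.

Lemma continuous_sum (S : topologicalType) (R : realType) (I : Type)
    (r : seq I) (h : I -> S -> R) :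
  (forall i, continuous (h i)) -> continuous (fun s => \sum_(i <- r) h i s).
Proof.
by move=> ch; apply: continuous_big => // x; exact: add_continuous.
Qed.

(** A cluster point of the image filter lies in [A], and neighbourhoods in the
    subtype are traces of neighbourhoods in [T]. *)
Lemma set_type_compact (T : topologicalType) (A : set T) :
  compact A -> compact [set: set_type A].
Proof.
move=> cA F FF _.
have FA : (set_val @ F) A.
  apply: (@filterS _ F _ setT) => [[x Ax] _|]; last exact: filterT.
  exact: set_mem.
have [p [Ap clp]] := cA _ (fmap_proper_filter set_val FF) FA.
exists (exist _ p (mem_set Ap)); split=> // B C FB [_ [] [U oU <-] Up UC].
have FB' : (set_val @ F) (set_val @` B).
  by apply: (@filterS _ F _ B) FB => x Bx; exists x.
have nU : nbhs p U by apply: open_nbhs_nbhs; split.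
have [_ [[x Bx <-] Ux]] := clp _ _ FB' nU.
by exists x; split=> //; exact: UC.
Qed.

Lemma simplex_compact (R : realType) (X : finType) : compact (@simplex R X).
Proof.
pose cube : set 'rV[R]_#|X| :=
  [set v | forall i, `[0%R, 1%R]%classic (v ord0 i)].
apply: (@subclosed_compact _ _ cube); last 2 first.
- apply: (@rV_compact R _ (fun=> `[0%R, 1%R]%classic)) => i.
  exact: segment_compact.
- move=> v [v_ge0 v_sum] i; have := v_ge0 (enum_val i); rewrite enum_valK => vi0.
  rewrite /= in_itv/= vi0/= -v_sum (bigD1 (enum_val i))//= enum_valK lerDl.
  exact: sumr_ge0.
have -> : @simplex R X = \bigcap_(x in [set: X])
     ((fun v : 'rV[R]_#|X| => v 0 (enum_rank x)) @^-1` [set t | 0 <= t])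
   `&` ((fun v : 'rV[R]_#|X| => \sum_(x : X) v 0 (enum_rank x))
          @^-1` [set t | t = 1]).
  apply/seteqP; split=> v [v_ge0 v_sum]; split=> // x; last exact: v_ge0.
  by move=> _; exact: v_ge0.
apply: closedI.
  apply: closed_bigI => x _; apply: preimage_closed; last exact: closed_ge.
  by move=> v _; exact: mx_coord_continuous.
apply: preimage_closed; last exact: closed_eq.
by move=> v _; apply: continuous_sum => x; exact: mx_coord_continuous.
Qed.

(** * Integrals of continuous functions against Borel probabilities *)

Section borel.
Context (R : realType) (T : ptopologicalType).
Local Notation B := (g_sigma_algebraType (@open T)).

Lemma continuous_borel_measurable (h : T -> R) :
  continuous h -> measurable_fun [set: B] (h : B -> R).
Proof.
move=> /continuousP ch.
apply: (measurability _ (RGenOpens.measurableE R)) => _ [_ [a [b ->] <-]].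
by rewrite setTI; apply: sub_sigma_algebra; apply: ch; exact: interval_open.
Qed.

Lemma continuous_integrable (P : probability B R) (h : T -> R) :
  compact [set: T] -> continuous h ->
  P.-integrable [set: B] (EFin \o (h : B -> R)).
Proof.
move=> cT ch; apply: measurable_bounded_integrable => //.
- by rewrite (le_lt_trans (probability_le1 P _)) ?ltry.
- exact: continuous_borel_measurable.
have /compact_bounded[M [Mr Mh]] : compact (h @` [set: T]).
  by apply: continuous_compact => //; exact: continuous_subspaceT.
by exists M; split=> // x Mx y _; apply: Mh => //; exists y.
Qed.

Lemma Rintegral_sum (P : probability B R) (I : Type) (r : seq I)
    (h : I -> T -> R) :
  compact [set: T] -> (forall i, continuous (h i)) ->
  (\int[P]_(x in setT) (\sum_(i <- r) h i x) =
    \sum_(i <- r) \int[P]_(x in setT) h i x)%R.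
Proof.
move=> cT ch; elim: r => [|i r IH].
  under eq_Rintegral do rewrite big_nil.
  by rewrite big_nil Rintegral_cst// mul0r.
under eq_Rintegral do rewrite big_cons.
rewrite big_cons RintegralD ?IH//; apply: continuous_integrable => //.
exact: continuous_sum.
Qed.

End borel.

Section discrete_probability.
Context (R : realType) (T : ptopologicalType) (d : nat).
Local Notation B := (g_sigma_algebraType (@open T)).

(** The law is the combination of Dirac masses at the [t 0 i] with weights
    [w 0 i]. *)
Lemma discrete_probability (w : 'rV[R]_d) (t : 'rV[T]_d) :
  compact [set: T] -> (forall i, 0 <= w 0 i) -> \sum_i w 0 i = 1 ->
  exists P : probability B R, P (range (t 0)) = 1%E /\
    forall h : T -> R, continuous h ->
      (\int[P]_(x in setT) h x)%R = \sum_i w 0 i * h (t 0 i).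
Proof.
move=> cT w_ge0 w_sum.
(* [msum] sums a sequence of measures indexed by [nat], so the weights and the
   atoms are extended beyond [d] by junk values. *)
pose wt (k : nat) : {nonneg R} :=
  oapp (fun i => NngNum (w_ge0 i)) (NngNum (lexx 0)) (insub k).
pose pt (k : nat) : B := oapp (t 0) point (insub k).
have wtE (i : 'I_d) : (wt i)%:num = w 0 i by rewrite /wt valK.
have ptE (i : 'I_d) : pt i = t 0 i by rewrite /pt valK.
pose m : {measure set B -> \bar R} :=
  msum (fun k => mscale (wt k) (\d_(pt k) : {measure set B -> \bar R})) d.
have mE (A : set B) : (forall i, A (t 0 i)) -> m A = 1%E.
  move=> At; rewrite /m/= /msum -w_sum -sumEFin; apply: eq_bigr => i _.
  transitivity ((wt i)%:num%:E * \d_(pt i) A)%E => //.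
  by rewrite diracE wtE ptE mem_set// mule1.
have m_setT : m setT = 1%E by exact: mE.
pose P : probability B R := HB.pack_for (probability B R) (Measure.sort m)
  (Measure_isProbability.Build _ _ _ m m_setT).
have intP_ge0 (h : T -> R) : continuous h -> (forall x, 0 <= h x) ->
    (\int[P]_(x in setT) h x)%R = \sum_i w 0 i * h (t 0 i).
  move=> ch h_ge0; have /measurable_EFinP mh := continuous_borel_measurable ch.
  rewrite /Rintegral -[LHS]/(fine (\int[m]_(x in [set: B]) (h x)%:E)).
  rewrite ge0_integral_measure_sum//; last by move=> x _; rewrite lee_fin.
  transitivity (fine (\sum_(i < d) (w 0 i * h (t 0 i))%:E)%E); last by rewrite sumEFin.
  congr fine; apply: eq_bigr => i _.
  rewrite ge0_integral_mscale//; last by move=> x _; rewrite lee_fin.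
  by rewrite integral_dirac// diracT mul1e wtE ptE.
exists P; split=> [|h ch]; first by apply: mE => i; exists i.
(* The general case reduces to non-negative functions by
   [h = (`|h| + h) - `|h|]. *)
have cabs : continuous (fun x => `|h x|).
  by move=> x; apply: cvg_norm; exact: ch.
have cD : continuous (fun x => `|h x| + h x).
  by move=> x; apply: cvgD; [exact: cabs|exact: ch].
transitivity (\int[P]_(x in setT) ((`|h x| + h x) - `|h x|))%R.
  by apply: eq_Rintegral => x _; rewrite addrAC subrr add0r.
rewrite RintegralB//; [|exact: continuous_integrable..].
have absD_ge0 x : 0 <= `|h x| + h x by rewrite -lerBlDr sub0r -normrN ler_norm.
rewrite !intP_ge0//.
by rewrite -sumrB; apply: eq_bigr => i _; rewrite -mulrBr addrAC subrr add0r.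
Qed.

End discrete_probability.

(** * Moments of finitely supported laws *)

Section moments.
Context (R : realType) (T : ptopologicalType) (d : nat) (g : 'I_d -> T -> R).
Local Notation B := (g_sigma_algebraType (@open T)).

(** A pair [wt] stands for the law with an atom of mass [wt.1 0 i] at each
    [wt.2 0 i]; atoms may coincide and masses may vanish, so that these pairs
    form a closed set. *)
Definition finite_laws : set ('rV[R]_d * 'rV[T]_d) :=
  [set wt : 'rV[R]_d * 'rV[T]_d |
     (forall i, 0 <= wt.1 0 i) /\ \sum_i wt.1 0 i = 1].

Definition moment (wt : 'rV[R]_d * 'rV[T]_d) : 'rV[R]_d :=
  \row_j \sum_i wt.1 0 i * g j (wt.2 0 i).

Hypothesis cT : compact [set: T].
Hypothesis cg : forall j, continuous (g j).

Lemma weight_continuous i :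
  continuous (fun wt : 'rV[R]_d * 'rV[T]_d => wt.1 0 i).
Proof.
move=> wt; apply: (@continuous_comp _ _ _ fst (fun w : 'rV[R]_d => w 0 i)).
  exact: cvg_fst.
exact: mx_coord_continuous.
Qed.

Lemma finite_laws_compact : compact finite_laws.
Proof.
pose box : set ('rV[R]_d * 'rV[T]_d) :=
  [set w : 'rV[R]_d | forall i, `[0%R, 1%R]%classic (w ord0 i)]
  `*` [set t : 'rV[T]_d | forall i, [set: T] (t ord0 i)].
apply: (@subclosed_compact _ _ box); last 2 first.
- apply: compact_setX.
    apply: (@rV_compact R _ (fun=> `[0%R, 1%R]%classic)) => i.
    exact: segment_compact.
  exact: (@rV_compact T _ (fun=> setT)).
- move=> wt [w_ge0 w_sum]; split=> // i.
  rewrite /= in_itv/= w_ge0/= -w_sum (bigD1 i)//= lerDl.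
  exact: sumr_ge0.
have -> : finite_laws = \bigcap_(i in [set: 'I_d])
     ((fun wt : 'rV[R]_d * 'rV[T]_d => wt.1 0 i) @^-1` [set s | 0 <= s])
   `&` ((fun wt : 'rV[R]_d * 'rV[T]_d => \sum_i wt.1 0 i)
          @^-1` [set s | s = 1]).
  apply/seteqP; split=> wt [w_ge0 w_sum]; split=> // i; last exact: w_ge0.
  by move=> _; exact: w_ge0.
apply: closedI.
  apply: closed_bigI => i _; apply: preimage_closed; last exact: closed_ge.
  by move=> wt _; exact: weight_continuous.
apply: preimage_closed; last exact: closed_eq.
by move=> wt _; apply: continuous_sum => i; exact: weight_continuous.
Qed.

Lemma moment_continuous : continuous moment.
Proof.
apply: continuous_mx => k j; under eq_fun do rewrite mxE.
have t_cont i : continuous (fun wt : 'rV[R]_d * 'rV[T]_d => wt.2 0 i).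
  move=> wt; apply: (@continuous_comp _ _ _ snd (fun t : 'rV[T]_d => t 0 i)).
    exact: cvg_snd.
  exact: mx_coord_continuous.
apply: continuous_sum => i wt; apply: cvgM; first exact: weight_continuous.
apply: (@continuous_comp _ _ _
  (fun wt : 'rV[R]_d * 'rV[T]_d => wt.2 0 i) (g j)).
  exact: t_cont.
exact: cg.
Qed.

Variable b : 'I_d -> R.
Hypothesis gb : forall x, \sum_j g j x * b j = 1.

(** The total mass is itself a linear function of the moments, so a change of
    weights that preserves the moments preserves it too. *)
Lemma moment_mass wt : \sum_j moment wt 0 j * b j = \sum_i wt.1 0 i.
Proof.
under eq_bigr do rewrite mxE mulr_suml.
rewrite exchange_big; apply: eq_bigr => i _ /=.
by under eq_bigr do rewrite -mulrA; rewrite -mulr_sumr gb mulr1.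
Qed.

(** Mixing a [d]-atom law with a Dirac mass gives [d.+1] atoms, and
    [caratheodory_step] makes one of them superfluous.  This is all the convexity
    of the set of moment vectors that the projection argument uses. *)
Lemma moment_segment wt (x : T) (s : R) :
  finite_laws wt -> 0 <= s <= 1 ->
  exists2 wt', finite_laws wt' &
    moment wt' = (1 - s) *: moment wt + s *: \row_j g j x.
Proof.
move=> [w_ge0 w_sum] /andP[s_ge0 s_le1].
(* The added atom [x], of mass [s], has index [ord0]. *)
pose t0 (i : 'I_d.+1) : T := oapp (wt.2 0) x (unlift ord0 i).
pose w0 : 'rV[R]_d.+1 :=
  \row_i oapp (fun k => (1 - s) * wt.1 0 k) s (unlift ord0 i).
pose G : 'M[R]_(d.+1, d) := \matrix_(i, j) g j (t0 i).
have w0G : w0 *m G = (1 - s) *: moment wt + s *: \row_j g j x.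
  apply/rowP => j.
  rewrite !mxE big_ord_recl !mxE /t0 unlift_none/= addrC mulr_sumr.
  by congr (_ + _); apply: eq_bigr => i _; rewrite !mxE /t0 liftK/= mulrA.
have w0_ge0 i : 0 <= w0 0 i.
  rewrite mxE; case: unliftP => [k _|_] //=.
  by apply: mulr_ge0; [rewrite subr_ge0|exact: w_ge0].
have Gb : G *m \col_j b j = const_mx 1.
  apply/matrixP => i k; rewrite !mxE -(gb (t0 i)).
  by apply: eq_bigr => j _; rewrite !mxE.
have [w' w'G [w'_ge0 [i0 w'i0]]] := caratheodory_step Gb w0_ge0.
pose wt' : 'rV[R]_d * 'rV[T]_d :=
  (\row_i w' 0 (lift i0 i), \row_i t0 (lift i0 i)).
have wt'G : moment wt' = w' *m G.
  apply/rowP => j; rewrite !mxE (bigD1_ord i0)//= w'i0 mul0r add0r.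
  by apply: eq_bigr => i _; rewrite !mxE.
exists wt'; last by rewrite wt'G w'G.
split=> [i|]; first by rewrite mxE.
rewrite -moment_mass wt'G w'G w0G.
transitivity ((1 - s) * (\sum_j moment wt 0 j * b j) + s * (\sum_j g j x * b j)).
  rewrite !mulr_sumr -big_split/=; apply: eq_bigr => j _.
  have -> : ((1 - s) *: moment wt + s *: \row_j g j x) 0 j =
      (1 - s) * moment wt 0 j + s * g j x by rewrite !mxE.
  by rewrite mulrDl !mulrA.
by rewrite moment_mass gb w_sum !mulr1 subrK.
Qed.

(** A point mass; there is room for an atom because without any [g j] the
    constant 1 would be an empty sum. *)
Lemma finite_laws_nonempty : finite_laws !=set0.
Proof.
have [i0 _] : exists i0 : 'I_d, true.
  case: (posnP d) => [d0|d_gt0]; last by exists (Ordinal d_gt0).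
  have := gb point; rewrite big1 => [/eqP|i _]; first by rewrite eq_sym oner_eq0.
  by move: (ltn_ord i); rewrite {2}d0.
exists (delta_mx 0 i0, const_mx point); split=> [i|/=]; first by rewrite mxE ler0n.
rewrite (bigD1 i0)//= mxE !eqxx big1 ?addr0// => i /negPf ii0.
by rewrite mxE ii0 andbF.
Qed.

(** Among [d]-atom laws, take one whose moments are closest to the target.  If
    they differed from it, then since the integral of
    [x |-> (y - c) . (g x - c)] is [|y - c| ^ 2 > 0], this function would be
    positive at some [x], and moving mass to [x] would come closer. *)
Lemma moments_finite_law (P : probability B R) :
  exists2 wt, finite_laws wt &
    moment wt = \row_j (\int[P]_(x in setT) g j x)%R.
Proof.
set y : 'rV[R]_d := \row_j _.
pose dist (z : 'rV[R]_d) := \sum_j (y 0 j - z 0 j) ^+ 2.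
have dist_cont : continuous (fun wt => dist (moment wt)).
  apply: continuous_sum => j wt; apply: (@continuous_comp _ _ _
    (fun wt => y 0 j - moment wt 0 j) (fun r : R => r ^+ 2)); last first.
    exact: exprn_continuous.
  apply: cvgB; first exact: cvg_cst.
  apply: (@continuous_comp _ _ _ moment (fun z => z 0 j)).
    exact: moment_continuous.
  exact: mx_coord_continuous.
have [wt /set_mem lwt min_wt] := @compact_EVT_min _ _ _ _ finite_laws_nonempty
  finite_laws_compact (continuous_subspaceT dist_cont).
exists wt => //; set c := moment wt in min_wt *.
pose u j := y 0 j - c 0 j.
(* First-order optimality of [c] towards the moments of a point mass. *)
have variational (x : T) : \sum_j u j * (g j x - c 0 j) <= 0.
  set A := \sum_j _; pose C := \sum_j (g j x - c 0 j) ^+ 2.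
  have C_ge0 : 0 <= C by apply: sumr_ge0 => j _; exact: sqr_ge0.
  have quad s : 0 <= s <= 1 -> 0 <= s * (s * C - 2 * A).
    move=> s01; have [wt' /mem_set lwt' mwt'] := moment_segment x lwt s01.
    have := min_wt _ lwt'; rewrite mwt' -subr_ge0; congr (_ <= _).
    rewrite /dist -sumrB /C /A !mulr_sumr -sumrB mulr_sumr.
    apply: eq_bigr => j _; rewrite -/c.
    have -> : ((1 - s) *: c + s *: \row_k g k x) 0 j =
        (1 - s) * c 0 j + s * g j x.
      rewrite mxE [X in X + _]mxE [X in _ + X]mxE.
      by congr (_ + s * _); rewrite mxE.
    by rewrite /u; ring.
  (* If [A > 0], the step [A / (A + C)] decreases the distance: it lies in
     [0, 1], and its product with [C] is at most [A], hence below [2 * A]. *)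
  rewrite leNgt; apply/negP => A_gt0.
  have AC_gt0 : 0 < A + C by lra.
  have := quad (A / (A + C)).
  have s_gt0 : 0 < A / (A + C) by rewrite divr_gt0.
  rewrite ltW//= ler_pdivrMr// mul1r lerDl C_ge0 => /(_ isT).
  rewrite pmulr_rge0// leNgt => /negP; apply.
  rewrite subr_lt0 mulrAC ltr_pdivrMr// [ltRHS]mulrDr; nra.
have cB j : continuous (fun x => g j x - c 0 j).
  by move=> x; apply: cvgB; [exact: cg|exact: cvg_cst].
have cuB j : continuous (fun x => u j * (g j x - c 0 j)).
  by move=> x; apply: cvgM; [exact: cvg_cst|exact: cB].
have int_le0 : (\int[P]_(x in setT) \sum_j u j * (g j x - c 0 j) <= 0)%R.
  apply: (@le_trans _ _ (\int[P]_(x in setT) (0 : R))%R); last first.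
    by rewrite Rintegral_cst// mul0r.
  apply: le_Rintegral => //; apply: continuous_integrable => //.
    exact: continuous_sum.
  by move=> x; exact: cvg_cst.
have int_sq :
    (\int[P]_(x in setT) \sum_j u j * (g j x - c 0 j))%R = \sum_j u j ^+ 2.
  rewrite Rintegral_sum//; apply: eq_bigr => j _.
  rewrite RintegralZl//; last exact: continuous_integrable.
  rewrite RintegralB//; [|exact: continuous_integrable|]; last first.
    by apply: continuous_integrable => // x; exact: cvg_cst.
  rewrite Rintegral_cst// [X in fine X](probability_setT P) mulr1 expr2.
  by congr (_ * _); rewrite /u; congr (_ - _); rewrite mxE.
have u0 j : u j = 0.
  apply/eqP; rewrite -sqrf_eq0.
  have /eqP : \sum_j u j ^+ 2 = 0.
    by apply/le_anti; rewrite -{1}int_sq int_le0 sumr_ge0// => k _; exact: sqr_ge0.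
  rewrite psumr_eq0; last by move=> k _; exact: sqr_ge0.
  by move/allP/(_ j (mem_index_enum j)).
by apply/rowP => j; apply/eqP; rewrite eq_sym -subr_eq0; apply/eqP/u0.
Qed.
End moments.

(** * The optimal law *)

(** A finite subset of the simplex is closed, so the support lies in it as soon
    as it has full mass. *)
Lemma supp_finite (R : realType) (X : finType) (X0 : (0 < #|X|)%N) d
    (P : Delta2 R X0) (t : 'I_d -> Delta R X0) :
  P (range t) = 1%E -> (supp P #<= `I_d)%card.
Proof.
move=> Pt; pose u k : Delta R X0 := oapp t point (insub k).
apply: (@card_le_trans _ _ _ (u @` `I_d)); last exact: card_image_le.
apply: subset_card_le; apply: (@subset_trans _ (range t)); last first.
  by move=> _ [i _ <-]; exists (val i); [exact: ltn_ord|rewrite /u valK].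
apply: bigcap_inf; split=> //.
have tfin : finite_set (set_val @` range t).
  by apply: finite_image; apply: finite_image; exact: finite_finset.
have -> : range t =
    (set_val : Delta R X0 -> 'rV[R]_#|X|) @^-1` (set_val @` range t).
  by apply/seteqP; split=> nu; [exists nu|case=> nu' tnu' /val_inj <-].
apply: preimage_closed; first by move=> nu _; exact: initial_continuous.
have : hausdorff_space 'rV[R]_#|X| by exact: norm_hausdorff.
by move=> /hausdorff_accessible/accessible_finite_set_closed; exact.
Qed.

Theorem theorem1 (R : realType) (X : finType) (X0 : (0 < #|X|)%N) (n : nat)
    (V : 'I_n -> Delta R X0 -> R) (f : 'rV[R]_n -> R)
    (D : Delta R X0 -> set 'rV[R]_n) (mu : Delta R X0)
    (V_cont : forall i, continuous (V i)) (f_cont : continuous f)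
    (D_closed : forall nu, closed (D nu))
    (VD_mu : attainable V mu `&` D mu !=set0) :
  exists Pstar : Delta2 R X0,
    (supp Pstar #<= `I_((n + 1) * #|X|)%N)%card /\ solves V f D mu Pstar.
Proof.
have cDelta : compact [set: Delta R X0].
  exact: (set_type_compact (@simplex_compact R X)).
pose d := (#|X| + n)%N.
(* The first [#|X|] moments are the barycenter, the last [n] the
   expectations. *)
pose g (j : 'I_d) (nu : Delta R X0) : R :=
  match fintype.split j with inl k => (val nu) 0 k | inr i => V i nu end.
have gl (k : 'I_#|X|) : g (lshift n k) = fun nu => (val nu) 0 k.
  by rewrite /g -[lshift n k]/(unsplit (inl k)) unsplitK.
have gr (i : 'I_n) : g (rshift #|X| i) = V i.
  by rewrite /g -[rshift _ i]/(unsplit (inr i)) unsplitK.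
have cg j : continuous (g j).
  rewrite -[j]splitK; case: (fintype.split j) => [k|i] /=; last by rewrite gr.
  rewrite gl => nu.
  apply: (@continuous_comp _ _ _
    (set_val : Delta R X0 -> 'rV[R]_#|X|) (fun v => v 0 k)).
    exact: initial_continuous.
  exact: mx_coord_continuous.
(* The coordinates of a point of the simplex sum to 1. *)
pose b (j : 'I_d) : R := if fintype.split j is inl _ then 1 else 0.
have gb nu : \sum_j g j nu * b j = 1.
  rewrite big_split_ord/= [X in _ + X]big1 ?addr0; last first.
    by move=> i _; rewrite /b -[rshift _ i]/(unsplit (inr i)) unsplitK mulr0.
  have [_ /= <-] := set_mem (valP nu).
  rewrite [RHS](reindex_onto enum_val enum_rank) //=; last first.
    by move=> x _; rewrite enum_rankK.
  apply: eq_big => [k|k _]; first by rewrite enum_valK eqxx.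
  by rewrite gl enum_valK /b -[lshift n k]/(unsplit (inl k)) unsplitK mulr1.
pose bary (z : 'rV[R]_d) : 'rV[R]_#|X| := \row_k z 0 (lshift n k).
pose vals (z : 'rV[R]_d) : 'rV[R]_n := \row_i z 0 (rshift #|X| i).
have bary_cont : continuous bary.
  apply: continuous_mx => i k; under eq_fun do rewrite mxE.
  exact: mx_coord_continuous.
have vals_cont : continuous vals.
  apply: continuous_mx => i k; under eq_fun do rewrite mxE.
  exact: mx_coord_continuous.
have momc := moment_continuous cg.
have baryP (P : Delta2 R X0) z :
    z = \row_j (\int[P]_(nu in setT) g j nu)%R ->
  bary z = barycenter P /\ vals z = expectations V P.
  move=> ->; split; apply/rowP => k; rewrite !mxE.
    by rewrite gl.
  by rewrite gr.
have law_of (P : Delta2 R X0) := moments_finite_law cDelta cg gb P.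
(* The feasible finitely supported laws. *)
pose M := @finite_laws R (Delta R X0) d `&`
  ((fun wt => bary (moment g wt)) @^-1` [set val mu] `&`
   (fun wt => vals (moment g wt)) @^-1` D mu).
have feasM (Q : Delta2 R X0) : feasible V D mu Q ->
    exists2 wt, M wt & vals (moment g wt) = expectations V Q.
  move=> [DQ Qmu]; have [wt lwt mwt] := law_of Q.
  have [bwt vwt] := baryP Q _ mwt.
  by exists wt => //; split=> //; split; rewrite /= ?bwt ?vwt.
have M0 : M !=set0.
  have [_ [[Q Qmu <-] DQ]] := VD_mu.
  by have [wt Mwt _] := feasM Q (conj DQ Qmu); exists wt.
have cM : compact M.
  apply: compact_closedI; first exact: finite_laws_compact.
  apply: closedI; apply: preimage_closed => //.
  - move=> wt _; apply: continuous_comp; [exact: momc|exact: bary_cont].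
  - exact: (accessible_closed_set1 (hausdorff_accessible (@norm_hausdorff _ _))).
  - move=> wt _; apply: continuous_comp; [exact: momc|exact: vals_cont].
have cobj : continuous (fun wt => f (vals (moment g wt))).
  move=> wt; apply: (@continuous_comp _ _ _
    (fun wt => vals (moment g wt)) f); last exact: f_cont.
  by apply: continuous_comp; [exact: momc|exact: vals_cont].
have [wt /set_mem[[w_ge0 w_sum] [bwt vwt]] wt_max] :=
  compact_EVT_max M0 cM (continuous_subspaceT cobj).
have [P [Pt intP]] := discrete_probability wt.2 cDelta w_ge0 w_sum.
have [bP vP] : bary (moment g wt) = barycenter P /\
    vals (moment g wt) = expectations V P.
  by apply: baryP; apply/rowP => j; rewrite !mxE intP.
exists P; split.
  apply: card_le_trans (supp_finite Pt) _.
  by rewrite card_le_II /d mulnDl mul1n addnC leq_add2r leq_pmulr.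
have feasP : feasible V D mu P by split; rewrite -?vP -?bP.
split=> //; apply/le_anti/andP; split.
  by apply: ereal_sup_ubound; exists P.
apply: ge_ereal_sup => _ [Q /feasM[wt' Mwt' <-] <-].
by rewrite lee_fin -vP; apply: wt_max; exact: mem_set.
Qed.
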